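(* Let $\alpha\in[1/2,1]$ and $K\ge2$. For each element $e_i\in E$ let $\hat c_{i1}\ge\dots\ge\hat c_{iK}$ be the costs $c_{i1},\dots,c_{iK}$ in nonincreasing order, let $\hat c_i=\alpha\hat c_{i1}+(1-\alpha)\hat c_{i2}$, and let $\hat X\in\Phi$ minimize $\hat C(X)=\sum_{e_i\in X}\hat c_i$ over $X\in\Phi$. Then for any $X\in\Phi$ $$\mathrm{OWA}(\hat X)\le[\alpha K+(1-\alpha)(K-2)]\,\mathrm{OWA}(X),$$ where $\mathrm{OWA}(X)=\alpha\max_{1\le j\le K}F(X,\pmb{c}_j)+(1-\alpha)\min_{1\le j\le K}F(X,\pmb{c}_j)$ is the Hurwicz criterion.
   Context: $E=\{e_1,\dots,e_n\}$ is a finite set of elements, $\Phi\subseteq2^E$ is a (nonempty) set of feasible solutions, and $\Gamma=\{\pmb{c}_1,\dots,\pmb{c}_K\}$ is a scenario set of $K$ distinct cost scenarios $\pmb{c}_j=(c_{1j},\dots,c_{nj})$ with nonnegative entries. For $X\in\Phi$, $F(X,\pmb{c}_j)=\sum_{e_i\in X}c_{ij}$. *)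

(* Defs.v *)
(* The costs and alpha live in an arbitrary ordered field, the reals being one instance. *)
From HB Require Import structures.
From mathcomp Require Import all_boot all_order all_algebra.

Set Implicit Arguments.
Unset Strict Implicit.
Unset Printing Implicit Defensive.

Import Order.TTheory GRing.Theory Num.Theory.
Local Open Scope ring_scope.

(* The iteration starts from the first value f takes, so the default 0 is used
   only when K = 0. *)
Definition max_scen (R : realFieldType) (K : nat) (f : 'I_K -> R) : R :=
  \big[Num.max/head 0 (codom f)]_(j < K) f j.

Definition min_scen (R : realFieldType) (K : nat) (f : 'I_K -> R) : R :=
  \big[Num.min/head 0 (codom f)]_(j < K) f j.

Definition scenario (R : realFieldType) (E : finType) := {ffun E -> R}.

Definition cost (R : realFieldType) (E : finType) (X : {set E})
    (s : scenario R E) : R :=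
  \sum_(e in X) s e.

Definition OWA (R : realFieldType) (E : finType) (K : nat)
    (c : 'I_K -> scenario R E) (alpha : R) (X : {set E}) : R :=
  alpha * max_scen (fun j => cost X (c j))
  + (1 - alpha) * min_scen (fun j => cost X (c j)).

Definition sorted_costs (R : realFieldType) (E : finType) (K : nat)
    (c : 'I_K -> scenario R E) (e : E) : seq R :=
  sort >=%R [seq c j e | j : 'I_K].

(* Positions count from 0: entries 0 and 1 are the largest and second largest
   costs, with multiplicity. *)
Definition chat (R : realFieldType) (E : finType) (K : nat)
    (c : 'I_K -> scenario R E) (alpha : R) (e : E) : R :=
  alpha * (sorted_costs c e)`_0 + (1 - alpha) * (sorted_costs c e)`_1.

Definition Chat (R : realFieldType) (E : finType) (K : nat)
    (c : 'I_K -> scenario R E) (alpha : R) (X : {set E}) : R :=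
  \sum_(e in X) chat c alpha e.

Lemma max_scenP (R : realFieldType) (K : nat) (f : 'I_K -> R) (hK : (0 < K)%N) :
  (forall j, f j <= max_scen f) /\ (exists j, max_scen f = f j).
Proof.
split=> [j|]; first by rewrite /max_scen (bigD1 j) //= le_max lexx.
apply: (big_ind (fun x => exists j, x = f j)) => [|x y [i ->] [j ->]|j _].
- case: K f hK => // K f _; exists ord0.
  by rewrite codomE enum_ordSl.
- by case: (leP (f i) (f j)); [exists j | exists i].
- by exists j.
Qed.

Lemma min_scenP (R : realFieldType) (K : nat) (f : 'I_K -> R) (hK : (0 < K)%N) :
  (forall j, min_scen f <= f j) /\ (exists j, min_scen f = f j).
Proof.
split=> [j|]; first by rewrite /min_scen (bigD1 j) //= ge_min lexx.
apply: (big_ind (fun x => exists j, x = f j)) => [|x y [i ->] [j ->]|j _].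
- case: K f hK => // K f _; exists ord0.
  by rewrite codomE enum_ordSl.
- by case: (leP (f i) (f j)); [exists i | exists j].
- by exists j.
Qed.

Lemma sorted_costs_sorted (R : realFieldType) (E : finType) (K : nat)
    (c : 'I_K -> scenario R E) (e : E) :
  sorted >=%R (sorted_costs c e).
Proof. by apply: sort_sorted => x y; exact: le_total. Qed.

(* Main.v *)
Require Import Defs.
From HB Require Import structures.
From mathcomp Require Import all_boot all_order all_algebra.
From mathcomp Require Import ring lra.

(** Aggregated costs sandwich the criterion, [OWA <= Chat <= rho * OWA] with
    [rho = alpha K + (1 - alpha) (K - 2)], so minimality of [Xhat] for [Chat]
    gives the ratio.  The left bound holds since any two scenarios cost an
    element at most its two largest costs, and [alpha >= 1/2].  For the right
    bound, [Chat X] is at most [alpha] times the sum of all the scenario costs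
    of [X], hence at most [alpha ((K - 1) M + m)] with [M] and [m] the largest
    and smallest of these; this is at most [rho (alpha M + (1 - alpha) m)]. *)

Import Order.TTheory GRing.Theory Num.Theory.
Local Open Scope ring_scope.

Section TwoLargest.
Context {R : realFieldType} {I : finType} (f : I -> R).
Let s := sort >=%R [seq f i | i : I].

Lemma sort_two_largest : (1 < #|I|)%N ->
  exists t, [/\ s = [:: s`_0, s`_1 & t], s`_1 <= s`_0
              & {in t, forall x, x <= s`_1}].
Proof.
have: size s = #|I| by rewrite size_sort size_map -cardE.
have: sorted >=%R s by apply: sort_sorted => x y; exact: le_total.
case: s => [_ <- //|a [_ <- //|b t]] /= /andP[leba bt] _ _.
exists t; split=> //; apply/allP.
by apply: order_path_min bt => y x z /= yx zy; exact: le_trans zy yx.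
Qed.

Lemma le_two_largest (i j : I) : i != j -> f i <= s`_0 /\ f i + f j <= s`_0 + s`_1.
Proof.
move=> neq_ij.
have I_gt1 : (1 < #|I|)%N by apply/card_gt1P; exists i, j.
have [t [def_s le10 le_t]] := sort_two_largest I_gt1.
have le0 k : f k <= s`_0.
  have: f k \in s by rewrite mem_sort codom_f.
  rewrite def_s !inE => /or3P[/eqP-> //|/eqP-> //|/le_t/le_trans]; exact.
(* If one of the two values is at most the second entry, the other is at most the first; both
   exceeding the second entry is absurd. *)
split=> //; have [le_i1|lt1i] := leP (f i) s`_1.
  by rewrite addrC lerD.
have [le_j1|lt1j] := leP (f j) s`_1; first exact: lerD.
(* At most one position of [s] can exceed its second entry. *)
pose above x := s`_1 < x.
have: (1 < count above s)%N.
  have -> : count above s = #|[pred k | above (f k)]|.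
    by rewrite count_sort count_map -size_filter enumT cardE.
  by apply/card_gt1P; exists i, j.
have count_t : count above t = 0%N.
  apply/eqP; rewrite -leqn0 leqNgt -has_count; apply/hasPn => x /le_t.
  by rewrite leNgt.
by rewrite {1}def_s /= count_t /above ltxx; case: (_ < _).
Qed.

(** Sorting preserves the sum, and the entries after the first two are nonnegative. *)
Lemma two_largest_le_sum : (1 < #|I|)%N -> (forall i, 0 <= f i) ->
  0 <= s`_1 /\ s`_0 + s`_1 <= \sum_i f i.
Proof.
move=> I_gt1 f_ge0; have [t [def_s _ _]] := sort_two_largest I_gt1.
have s_ge0 x : x \in s -> 0 <= x by rewrite mem_sort => /codomP[i ->].
split; first by apply: s_ge0; rewrite def_s !inE eqxx orbT.
have -> : \sum_i f i = \sum_(x <- s) x.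
  by rewrite (perm_big _ (permEl (perm_sort _ _))) big_image.
rewrite def_s !big_cons addrA lerDl big_seq sumr_ge0 // => x tx.
by apply: s_ge0; rewrite def_s !inE tx !orbT.
Qed.

End TwoLargest.

Section Hurwicz.
Context {R : realFieldType} {E : finType} {K : nat}.
Context {c : 'I_K -> scenario R E} {alpha : R}.
Hypotheses (K_ge2 : (2 <= K)%N) (halpha : 1 / 2 <= alpha <= 1).

Lemma OWA_le_Chat (X : {set E}) : OWA c alpha X <= Chat c alpha X.
Proof.
have K_gt0 := ltnW K_ge2.
have [_ [j maxE]] := max_scenP (fun j => cost X (c j)) K_gt0.
have [min_le _] := min_scenP (fun j => cost X (c j)) K_gt0.
(* Any [k] other than the maximizer [j] will do: the minimizer may be [j] itself when all costs of
   [X] tie. *)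
have [k neq_jk] : exists k, j != k.
  have /card_gt1P[x [y [_ _ neq_xy]]] : (1 < #|'I_K|)%N by rewrite card_ord.
  by have [->|] := eqVneq j x; [exists y | exists x].
have /andP[ha1 ha2] := halpha.
rewrite /OWA maxE; apply: (@le_trans _ _ (alpha * cost X (c j)
    + (1 - alpha) * cost X (c k))).
  by rewrite lerD2l ler_wpM2l ?subr_ge0.
rewrite /cost !mulr_sumr -big_split; apply: ler_sum => e _ /=.
have [] := le_two_largest (fun i => c i e) _ _ neq_jk.
(* Weight the bound on [c j e] by [2 * alpha - 1] and the bound on [c j e + c k e] by
   [1 - alpha]. *)
rewrite /chat -/(sorted_costs c e); nra.
Qed.

Lemma Chat_le_OWA (X : {set E}) : (forall j e, 0 <= c j e) ->
  Chat c alpha X <= (alpha * K%:R + (1 - alpha) * (K%:R - 2)) * OWA c alpha X.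
Proof.
move=> c_ge0; have K_gt0 := ltnW K_ge2; have /andP[ha1 ha2] := halpha.
have Chat_le : Chat c alpha X <= alpha * \sum_j cost X (c j).
  rewrite /cost exchange_big mulr_sumr; apply: ler_sum => e _ /=.
  have [||] := two_largest_le_sum (fun i => c i e); rewrite ?card_ord //.
  (* As [1 - alpha <= alpha] and the second largest cost is nonnegative, its weight can be raised to
     [alpha]. *)
  rewrite /chat -/(sorted_costs c e); nra.
apply: (le_trans Chat_le); rewrite /OWA.
have [le_max _] := max_scenP (fun j => cost X (c j)) K_gt0.
have [min_le [k minE]] := min_scenP (fun j => cost X (c j)) K_gt0.
have := le_max k; rewrite /= -minE.
have : 0 <= min_scen (fun j => cost X (c j)) by rewrite minE sumr_ge0.
have : \sum_j cost X (c j) <= min_scen (fun j => cost X (c j))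
    + (K%:R - 1) * max_scen (fun j => cost X (c j)).
  rewrite (bigD1 k) //= -minE lerD2l.
  apply: le_trans (ler_sum _ (fun i _ => le_max i)) _.
  rewrite sumr_const cardC1 card_ord -[X in X <= _]mulr_natl -subn1.
  by rewrite natrB.
have K_ge2R : (2 : R) <= K%:R by rewrite ler_nat.
move: (max_scen _) (min_scen _) (\sum_j _) K%:R K_ge2R => M m S k' hk hS hm hM.
have hS' : alpha * S <= alpha * (m + (k' - 1) * M) by rewrite ler_wpM2l //; lra.
apply: (le_trans hS'); rewrite -subr_ge0.
(* The slack splits into two terms, nonnegative by [1 / 2 <= alpha <= 1], [m <= M], [2 <= k'] and
   [0 <= m]. *)
have -> : (alpha * k' + (1 - alpha) * (k' - 2)) * (alpha * M + (1 - alpha) * m)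
    - alpha * (m + (k' - 1) * M)
  = alpha * (2 * alpha - 1) * (M - m) + (1 - alpha) * (k' - 2) * m by ring.
by rewrite addr_ge0 // !mulr_ge0 //; lra.
Qed.

End Hurwicz.

Theorem theorem7 (R : realFieldType) (E : finType) (Phi : {set {set E}})
    (hPhi : Phi != set0) (K : nat) (hK : (2 <= K)%N)
    (c : 'I_K -> scenario R E) (hdistinct : injective c)
    (hc : forall (j : 'I_K) (e : E), 0 <= c j e)
    (alpha : R) (halpha : 1 / 2 <= alpha <= 1)
    (Xhat : {set E}) (hXhat : Xhat \in Phi)
    (hmin : forall Y : {set E}, Y \in Phi -> Chat c alpha Xhat <= Chat c alpha Y)
    (X : {set E}) (hX : X \in Phi) :
  OWA c alpha Xhat
  <= (alpha * K%:R + (1 - alpha) * (K%:R - 2)) * OWA c alpha X.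
Proof.
apply: le_trans (OWA_le_Chat hK halpha Xhat) _.
exact: le_trans (hmin X hX) (Chat_le_OWA hK halpha X hc).
Qed.
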